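(* Let $G$ be a simple graph on vertices $v_1,\dots,v_n$ with connected components $G_1,G_2,\dots,G_m$, where $m=n-k$, whose vertex sets are respectively $\{v_1,\dots,v_{n_1}\}$, $\{v_{n_1+1},\dots,v_{n_2}\}$, $\dots$, $\{v_{n_{m-1}+1},\dots,v_{n_m}\}$, with $n_m=n$. Let $F=\{f_i\}_{i\in[n]}$ be a $G(n,k)$-frame for $\mathbb{C}^k$ with frame operator $S$. Then the dual frames of $F$ are exactly the sequences of the form $$\{S^{-1}f_i+\nu_1\}_{i=1}^{n_1}\cup\{S^{-1}f_i+\nu_2\}_{i=n_1+1}^{n_2}\cup\cdots\cup\{S^{-1}f_i+\nu_m\}_{i=n_{m-1}+1}^{n},$$ where $\nu_1,\nu_2,\dots,\nu_m$ are arbitrary vectors in $\mathbb{C}^k$ (the unions denote concatenation of sequences).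
   Context: $[n]=\{1,\dots,n\}$. A sequence $\{f_i\}_{i\in[n]}$ in $\mathbb{C}^k$ is a frame for $\mathbb{C}^k$ if there are constants $A,B>0$ with $A\|f\|^2\le\sum_{i\in[n]}|\langle f,f_i\rangle|^2\le B\|f\|^2$ for all $f\in\mathbb{C}^k$ (inner product linear in the first argument). Its frame operator is $S(f)=\sum_{i\in[n]}\langle f,f_i\rangle f_i$, which is invertible. Its Gramian matrix is the $n\times n$ matrix whose $(i,j)$ entry is $\langle f_j,f_i\rangle$. A frame $\{g_i\}_{i\in[n]}$ for $\mathbb{C}^k$ is a dual frame of $\{f_i\}_{i\in[n]}$ if $f=\sum_{i\in[n]}\langle f,f_i\rangle g_i=\sum_{i\in[n]}\langle f,g_i\rangle f_i$ for all $f\in\mathbb{C}^k$. The Laplacian matrix of a simple graph $G$ with vertices $v_1,\dots,v_n$ is $L(G)=D(G)-A(G)$, where $D(G)$ is the diagonal matrix of vertex degrees and $A(G)$ is the adjacency matrix. A frame $\{f_i\}_{i\in[n]}$ for $\mathbb{C}^k$ is a $G(n,k)$-frame if its Gramian matrix equals $L(G)$. *)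

(* Defs.v *)
From HB Require Import structures.
From mathcomp Require Import all_boot all_order all_algebra.
From mathcomp Require Import spectral complex reals.

Set Implicit Arguments.
Unset Strict Implicit.
Unset Printing Implicit Defensive.

Import Order.TTheory GRing.Theory Num.Theory.
Local Open Scope ring_scope.
Local Open Scope complex_scope.

(* dotmx u v = \sum_j u_j * (v_j)^*, linear in the first argument. *)
Notation "''[' u , v ]" := (dotmx u v) : ring_scope.

Section Frames.
Variables (R : realType) (n k : nat).
Implicit Types f g : 'I_n -> 'rV[R[i]]_k.

Definition is_frame f : Prop :=
  exists A B : R, [/\ 0 < A, 0 < B &
    forall x : 'rV[R[i]]_k,
      A%:C * '[x, x] <= \sum_(i < n) `|'[x, f i]| ^+ 2 <= B%:C * '[x, x]].

Definition frame_op_fun f (x : 'rV[R[i]]_k) : 'rV[R[i]]_k :=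
  \sum_(i < n) '[x, f i] *: f i.

Fact frame_op_is_linear f : linear (frame_op_fun f).
Proof.
move=> a x y; rewrite /frame_op_fun scaler_sumr -big_split /=.
by apply: eq_bigr => i _; rewrite linearPl /= scalerDl scalerA.
Qed.

HB.instance Definition _ f :=
  GRing.isLinear.Build R[i] 'rV[R[i]]_k 'rV[R[i]]_k *:%R (frame_op_fun f)
    (frame_op_is_linear f).

Definition frame_op f : 'End('rV[R[i]]_k) := linfun (frame_op_fun f).

Definition gramian f : 'M[R[i]]_n := \matrix_(i, j) '[f j, f i].

Definition is_dual_frame f g : Prop :=
  is_frame g /\
  forall x : 'rV[R[i]]_k,
    x = \sum_(i < n) '[x, f i] *: g i /\ x = \sum_(i < n) '[x, g i] *: f i.

End Frames.

Section Graphs.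
Variable n : nat.
Implicit Type e : rel 'I_n.

Definition simple_graph e : Prop := symmetric e /\ irreflexive e.

Definition degree e (i : 'I_n) : nat := #|[set j | e i j]|.

Definition laplacian (K : pzRingType) e : 'M[K]_n :=
  diag_mx (\row_i (degree e i)%:R) - \matrix_(i, j) (e i j)%:R.

Definition components e : {set {set 'I_n}} :=
  equivalence_partition (connect e) [set: 'I_n].

(* With vertices numbered from 0, the j-th block of the cut points
   b 0 < b 1 < ... is {b j, ..., b j.+1 - 1}. *)
Definition block (b : nat -> nat) (j : nat) : {set 'I_n} :=
  [set i : 'I_n | (b j <= i < b j.+1)%N].

End Graphs.

Definition is_graph_frame (R : realType) (n k : nat) (e : rel 'I_n)
    (f : 'I_n -> 'rV[R[i]]_k) : Prop :=
  is_frame f /\ gramian f = laplacian R[i] e.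

(* Main.v *)
Require Import Defs.
From mathcomp Require Import all_boot all_order all_algebra.
From mathcomp Require Import spectral complex reals.
Set Implicit Arguments.
Unset Strict Implicit.
Unset Printing Implicit Defensive.
Import Order.TTheory GRing.Theory Num.Theory.
Local Open Scope ring_scope.
Local Open Scope sesquilinear_scope.

(** Write [Phi] for the n x k matrix whose rows are the frame vectors f_i, and
    [Phi^t*] for its conjugate transpose. Analysis is x |-> x Phi^t*, the frame
    operator is right multiplication by Phi^t* Phi, and the Gramian is the
    transpose of Phi Phi^t*.

    In this language g, with matrix [G], reconstructs through f exactly when
    Phi^t* G = 1. The other reconstruction formula, G^t* Phi = 1, is the
    conjugate transpose of that equation, and it already forces the frame
    inequalities for g, because every matrix is a bounded operator
    ([is_frame_leftinv]). The canonical dual Phi (Phi^t* Phi)^-1 is one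
    solution, so g is dual to f if and only if the matrix [D] of differences
    g_i - S^-1 f_i satisfies Phi^t* D = 0 ([dual_frameP]).

    Since Phi^t* D and Phi Phi^t* D vanish together ([mulmx_trmxC_ker]), and
    Phi Phi^t* is the Laplacian, the condition on D is that the Laplacian
    kills it. The quadratic form of the Laplacian is a sum of squares over the
    edges, so its kernel consists of the families that take equal values at
    the ends of each edge ([laplacian_ker]). Such families are those constant
    on each connected component, that is, on each block
    ([edge_constant_blockP]); the constants are the vectors nu_j. *)

(** * Conjugate transposes and positivity *)

Section ConjugateTranspose.
Variable C : numClosedFieldType.

Lemma trmxC_mul m n p (A : 'M[C]_(m, n)) (B : 'M_(n, p)) :
  (A *m B)^t* = B^t* *m A^t*.
Proof. by rewrite trmx_mul map_mxM. Qed.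

Lemma trmxC1 n : (1%:M : 'M[C]_n)^t* = 1%:M.
Proof. by rewrite trmx1 map_mx1. Qed.

(** The rows of [A] are then orthogonal to themselves. *)
Lemma mul_trmxC_eq0 m n (A : 'M[C]_(m, n)) : A *m A^t* = 0 -> A = 0.
Proof.
move=> /orthomx1P/orthomx_disj AA0; apply/eqP.
by rewrite -submx0 -AA0 sub_capmx submx_refl.
Qed.

(** For [E := A^t* *m D] the hypothesis gives [E^t* *m E = 0]. This is what
    lets the Gramian stand in for the analysis matrix. *)
Lemma mulmx_trmxC_ker m n p (A : 'M[C]_(m, n)) (D : 'M_(m, p)) :
  A *m A^t* *m D = 0 <-> A^t* *m D = 0.
Proof.
split=> [AAD0|AD0]; last by rewrite -mulmxA AD0 mulmx0.
have: (A^t* *m D)^t* = 0.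
  by apply: mul_trmxC_eq0; rewrite trmxCK trmxC_mul trmxCK -!mulmxA
    [A *m _]mulmxA AAD0 mulmx0.
by move/(congr1 (fun M => M^t*)); rewrite trmxCK trmx0 map_mx0.
Qed.

End ConjugateTranspose.

(** * The Laplacian kernel *)

Lemma laplacian_sym (K : pzRingType) n (e : rel 'I_n) :
  symmetric e -> (laplacian K e)^T = laplacian K e.
Proof.
move=> esym; rewrite /laplacian linearB /= tr_diag_mx; congr (_ - _).
by apply/matrixP=> i j; rewrite !mxE esym.
Qed.

Section LaplacianKernel.
Variables (C : numClosedFieldType) (n : nat) (e : rel 'I_n).

Lemma laplacian_mulE p (D : 'M[C]_(n, p)) i l :
  (laplacian C e *m D) i l = \sum_j (e i j)%:R * (D i l - D j l).
Proof.
rewrite /laplacian mulmxBl mul_diag_mx !mxE.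
under eq_bigr do rewrite mxE.
under [RHS]eq_bigr do rewrite mulrBr.
rewrite sumrB -mulr_suml -natr_sum; congr (_%:R * _ - _).
by rewrite /degree -sum1dep_card big_mkcond; apply: eq_bigr => j _; case: (e i j).
Qed.

(** For a column c, symmetrizing the quadratic form c^t* L c gives twice its
    value as the sum over ordered pairs (i, j) of adjacent vertices of
    |c_i - c_j| ^ 2. It vanishes when L c = 0, hence so does each term. *)
Lemma laplacian_ker p (D : 'M[C]_(n, p)) : symmetric e ->
  laplacian C e *m D = 0 <-> forall i j, e i j -> row i D = row j D.
Proof.
move=> esym; split=> [LD0 i j eij|Dedge]; last first.
  apply/matrixP=> i l; rewrite laplacian_mulE mxE big1 // => j _.
  case: (boolP (e i j)) => [/Dedge/rowP/(_ l)|_]; last by rewrite mul0r.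
  by rewrite !mxE => ->; rewrite subrr mulr0.
apply/rowP=> l; rewrite !mxE.
pose d i j : C := (e i j)%:R * `|D i l - D j l| ^+ 2.
have d_ge0 i' j' : 0 <= d i' j' by rewrite mulr_ge0 ?ler0n ?exprn_ge0.
have sum_d : \sum_i' \sum_j' d i' j' = 0.
  pose s := \sum_i' (D i' l)^* * (laplacian C e *m D) i' l.
  have s0 : s = 0 by rewrite /s big1 // => i' _; rewrite LD0 mxE mulr0.
  have sE : s = \sum_i' \sum_j' (e i' j')%:R * ((D i' l)^* * (D i' l - D j' l)).
    apply: eq_bigr => i' _; rewrite laplacian_mulE mulr_sumr.
    by apply: eq_bigr => j' _; rewrite mulrCA.
  transitivity (s + s); last by rewrite s0 addr0.
  (* Exchanging i' and j' in the second copy leaves the weight fixed, and the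
     two copies add up to the squared distance. *)
  rewrite sE [X in _ = _ + X]exchange_big -big_split; apply: eq_bigr => i' _ /=.
  rewrite -big_split; apply: eq_bigr => j' _ /=.
  rewrite [e j' i']esym -mulrDr /d normCK rmorphB /=.
  by rewrite -[D j' l - _]opprB mulrN -mulrBl; congr (_ * _); rewrite mulrC.
have /eqP := sum_d; rewrite psumr_eq0 => [|i' _]; last exact: sumr_ge0.
move=> /allP/(_ i (mem_index_enum _)) /=.
rewrite psumr_eq0 // => /allP/(_ j (mem_index_enum _)) /=.
by rewrite /d eij mul1r expf_eq0 normr_eq0 subr_eq0 => /eqP.
Qed.

End LaplacianKernel.

(** * Frames through their matrix *)

Section FrameMatrix.
Variables (R : realType) (n k : nat).
Local Notation C := R[i].
Implicit Types f g : 'I_n -> 'rV[C]_k.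

Definition framemx f : 'M[C]_(n, k) := \matrix_i f i.

Lemma analysisE f (x : 'rV_k) : x *m (framemx f)^t* = \row_i '[x, f i].
Proof.
apply/rowP=> i; rewrite !mxE dotmxE !mxE.
by apply: eq_bigr => j _; rewrite !mxE.
Qed.

Lemma synthesisE f (x : 'rV_k) g :
  x *m (framemx f)^t* *m framemx g = \sum_i '[x, f i] *: g i.
Proof.
rewrite analysisE mulmx_sum_row; apply: eq_bigr => i _.
by rewrite rowK mxE.
Qed.

Lemma reconstructionP f g :
  (forall x : 'rV_k, x = \sum_i '[x, f i] *: g i) <->
  (framemx f)^t* *m framemx g = 1%:M.
Proof.
split=> [rec|fg1 x]; last by rewrite -synthesisE -mulmxA fg1 mulmx1.
by apply/row_matrixP=> i; rewrite rowE mulmxA synthesisE -rec row1.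
Qed.

Lemma sum_sqr_coefE f (x : 'rV_k) :
  \sum_i `|'[x, f i]| ^+ 2 =
  '[x *m (framemx f)^t*, x *m (framemx f)^t*].
Proof.
rewrite dotmxE mxE; apply: eq_bigr => i _.
by rewrite analysisE !mxE normCK.
Qed.

(** Applying Cauchy-Schwarz to each coordinate of [y *m M] bounds it by the
    sum of the squared norms of the columns of [M]. Both frame inequalities
    come from this one bound. *)
Lemma mulmx_bounded p q (M : 'M[C]_(p, q)) :
  exists2 B : R, 0 < B &
    forall y : 'rV_p, '[y *m M, y *m M] <= (B%:C)%C * '[y, y].
Proof.
pose c (j : 'I_q) : 'rV[C]_p := (col j M)^t*.
have c_ge0 : 0 <= \sum_j '[c j, c j] by apply: sumr_ge0 => j _; apply: dnorm_ge0.
have cE : ((complex.Re (\sum_j '[c j, c j]))%:C)%C = \sum_j '[c j, c j].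
  by apply: RRe_real; apply: ger0_real.
(* The summand 1 keeps the bound positive when [M] vanishes. *)
exists (1 + complex.Re (\sum_j '[c j, c j])).
  by rewrite ltr_pwDl ?ltr01 // -ler0c cE.
move=> y; rewrite rmorphD /= cE mulrDl mul1r mulr_suml.
apply: ler_wpDl; first exact: dnorm_ge0.
rewrite {1}dotmxE mxE; apply: ler_sum => j _.
have -> : (y *m M) 0 j = '[y, c j].
  by rewrite dotmxE trmxCK !mxE; apply: eq_bigr => l _; rewrite !mxE.
have -> : ((y *m M)^t*) j 0 = '[y, c j]^*.
  rewrite dotmxE trmxCK !mxE; congr (_^*).
  by apply: eq_bigr => l _; rewrite !mxE.
by rewrite -normCK mulrC; apply: (CauchySchwarz (@dotmx C p)).
Qed.

(** The upper bound is boundedness of the analysis matrix; the lower one is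
    boundedness of [G], which recovers x from its coefficients. *)
Lemma is_frame_leftinv f (G : 'M_(n, k)) :
  (framemx f)^t* *m G = 1%:M -> is_frame f.
Proof.
move=> fG1; have [A A_gt0 leA] := mulmx_bounded G.
have [B B_gt0 leB] := mulmx_bounded ((framemx f)^t*).
exists A^-1, B; split=> [||x]; rewrite ?invr_gt0 // sum_sqr_coefE leB andbT.
have AC_gt0 : 0 < (A%:C)%C :> C by rewrite ltcR.
rewrite fmorphV ler_pdivrMl //.
by rewrite -{1 2}[x]mulmx1 -fG1 mulmxA.
Qed.

Lemma frame_mulmx_inj f : is_frame f ->
  forall x : 'rV_k, x *m (framemx f)^t* = 0 -> x = 0.
Proof.
case=> A [B [A_gt0 _ bnd]] x x0; apply/eqP; have /andP[+ _] := bnd x.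
have AC_gt0 : 0 < (A%:C)%C :> C by rewrite ltcR.
rewrite sum_sqr_coefE x0 linear0l pmulr_rle0 // => xx_le0.
rewrite -(dnorm_eq0 (@dotmx C k)) eq_le xx_le0; exact: dnorm_ge0.
Qed.

Lemma frame_op_unit f : is_frame f -> (framemx f)^t* *m framemx f \in unitmx.
Proof.
move=> fr; rewrite -row_free_unit -kermx_eq0; apply/eqP/row_matrixP=> i.
rewrite row0; apply: frame_mulmx_inj fr _ _; apply: mul_trmxC_eq0.
rewrite trmxC_mul trmxCK mulmxA -[X in X *m _]mulmxA.
by rewrite -row_mul mulmx_ker row0 mul0mx.
Qed.

Lemma frame_opE f x : frame_op f x = x *m ((framemx f)^t* *m framemx f).
Proof. by rewrite lfunE /= mulmxA synthesisE. Qed.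

Lemma frame_op_invE f x : is_frame f ->
  ((frame_op f)^-1)%VF x = x *m invmx ((framemx f)^t* *m framemx f).
Proof.
move=> fr; have Su := frame_op_unit fr.
have Sinj : lker (frame_op f) == 0%VS.
  apply/lker0P => y z; rewrite !frame_opE => /(congr1 (mulmx^~ _)).
  by move/(_ _ (invmx ((framemx f)^t* *m framemx f))); rewrite !mulmxK.
by rewrite -{1}[x](mulmxKV Su) -frame_opE (lker0_lfunK Sinj).
Qed.

(** Being dual is the inhomogeneous linear equation
    [(framemx f)^t* *m framemx g = 1%:M], and the canonical dual is a
    particular solution, so differences with it solve the homogeneous one. *)
Lemma dual_frameP f g : is_frame f ->
  is_dual_frame f g <->
  (framemx f)^t* *m
    \matrix_i (g i - ((frame_op f)^-1)%VF (f i)) = 0.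
Proof.
move=> fr; have Su := frame_op_unit fr.
have -> : \matrix_i (g i - ((frame_op f)^-1)%VF (f i)) =
    framemx g - framemx f *m invmx ((framemx f)^t* *m framemx f).
  apply/row_matrixP=> i.
  by rewrite rowK linearB /= row_mul !rowK frame_op_invE.
rewrite mulmxBr [_ *m (_ *m invmx _)]mulmxA (mulmxV Su).
split=> [[_ rec]|/eqP].
  have /reconstructionP -> : forall x : 'rV_k, x = \sum_i '[x, f i] *: g i.
    by move=> x; case: (rec x).
  by rewrite subrr.
rewrite subr_eq0 => /eqP fg1.
have gf1 : (framemx g)^t* *m framemx f = 1%:M.
  by rewrite -[LHS]trmxCK trmxC_mul trmxCK fg1 trmxC1.
split=> [|x]; first exact: is_frame_leftinv gf1.
by split; [apply/(reconstructionP f g).2|apply/(reconstructionP g f).2].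
Qed.

Lemma gramianE f : gramian f = (framemx f *m (framemx f)^t*)^T.
Proof.
apply/matrixP=> i j; rewrite !mxE dotmxE mxE.
by apply: eq_bigr => l _; rewrite !mxE.
Qed.

End FrameMatrix.

(** * Families constant on components *)

Lemma edge_constantP (T : finType) (e : rel T) (V : Type) (d : T -> V) :
  (forall i j, e i j -> d i = d j) <->
  (forall i j, connect e i j -> d i = d j).
Proof.
split=> [dE i j|dE i j eij]; last by apply/dE/connect1.
case/connectP=> p; elim: p i => [|z p IHp] i /= => [_ ->//|/andP[eiz pz] jE].
by rewrite (dE _ _ eiz); apply: IHp.
Qed.

Section Blocks.
Variables (n m : nat) (e : rel 'I_n) (b : nat -> nat).
Hypotheses (esym : symmetric e)
  (compE : components e = [set block n b j | j : 'I_m]).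

Let connect_equiv : {in [set: 'I_n] & &, equivalence_rel (connect e)}.
Proof.
have cs : connect_sym e by apply: sym_connect_sym.
move=> x y z _ _ _; split; first exact: connect0.
by move/(same_connect cs) ->.
Qed.

Lemma block_connect (j : 'I_m) i i' :
  i \in block n b j -> connect e i i' = (i' \in block n b j).
Proof.
have : block n b j \in components e by rewrite compE; apply: imset_f.
case/imsetP=> x _ ->; rewrite !inE.
by move/(same_connect (sym_connect_sym esym)) ->.
Qed.

Lemma block_ex i : exists j : 'I_m, i \in block n b j.
Proof.
have /and3P[/eqP cov _ _] := equivalence_partitionP connect_equiv.
have : i \in cover (components e) by rewrite cov inE.
by rewrite compE cover_imset => /bigcupP[j _ ij]; exists j.
Qed.

(** A block is a whole connected component, and every vertex lies in a block.
    This turns existence of the constants into a condition on edges. *)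
Lemma edge_constant_blockP (V : nmodType) (d : 'I_n -> V) :
  (forall i i', e i i' -> d i = d i') <->
  exists nu : 'I_m -> V,
    forall (j : 'I_m) i, i \in block n b j -> d i = nu j.
Proof.
rewrite edge_constantP; split=> [dC|[nu nuE] i i' cii'].
  exists (fun j => if [pick i in block n b j] is Some i then d i else 0).
  move=> j i ij; case: pickP => [i' i'j|/(_ i)]; last by rewrite ij.
  by apply: dC; rewrite (block_connect _ ij).
have [j ij] := block_ex i.
by rewrite (nuE j i) // (nuE j i') // -(block_connect _ ij).
Qed.

End Blocks.

(** * Dual frames of a graph frame *)

Theorem theorem3p13 (R : realType) (n k m : nat) (e : rel 'I_n)
    (b : nat -> nat) (F : 'I_n -> 'rV[R[i]]_k) :
  simple_graph e ->
  (m + k)%N = n ->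
  b 0%N = 0%N -> b m = n ->
  (forall j : nat, (j < m)%N -> (b j < b j.+1)%N) ->
  components e = [set block n b j | j : 'I_m] ->
  is_graph_frame e F ->
  forall H : 'I_n -> 'rV[R[i]]_k,
    is_dual_frame F H <->
    exists nu : 'I_m -> 'rV[R[i]]_k,
      forall (j : 'I_m) (i : 'I_n), i \in block n b j ->
        H i = ((frame_op F)^-1)%VF (F i) + nu j.
Proof.
move=> [esym _] _ _ _ _ compE [frF gramF] H.
have FFL : framemx F *m (framemx F)^t* = laplacian R[i] e.
  by rewrite -(laplacian_sym _ esym) -gramF gramianE trmxK.
rewrite (dual_frameP H frF) -mulmx_trmxC_ker FFL laplacian_ker //.
pose d i := H i - ((frame_op F)^-1)%VF (F i).
transitivity (forall i i', e i i' -> d i = d i').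
  by split=> dE i i' /dE; rewrite !rowK.
rewrite (edge_constant_blockP esym compE).
split=> -[nu nuE]; exists nu => j i /nuE.
  by rewrite -/(d i) => <-; rewrite addrC subrK.
by rewrite /d => ->; rewrite addrC addKr.
Qed.
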